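(* Consider the resampled M/M/1 queue (in which the arrival and service rate pair is resampled at Poisson epochs of rate $q$ from a distribution with finite support), and let $Q$ be its steady-state queue length. As $\rho\uparrow 1$, the random variable $(1-\rho)Q$ converges in distribution to an exponentially distributed random variable with mean $\sigma^2_{\Lambda,\mathcal{M}}/(2\,\mathbb{E}\mathcal{M})$, where $$\sigma^2_{\Lambda,\mathcal{M}}:=\big(\mathrm{Var}\,\Lambda-2\,\mathrm{Cov}(\Lambda,\mathcal{M})+\mathrm{Var}\,\mathcal{M}\big)\frac{2}{q}+2\,\mathbb{E}\mathcal{M},$$ with the moments of $\Lambda$ in this formula evaluated in the limit $\rho\uparrow 1$ (i.e. at $\mathbb{E}\Lambda=\mathbb{E}\mathcal{M}$).
   Context: Resampled M/M/1 queue. Let $d\in\mathbb{N}$, let $\boldsymbol{\pi}=(\pi_1,\dots,\pi_d)$ be a probability vector, $q>0$, and let $(\lambda_i,\mu_i)$, $i=1,\dots,d$, be pairs of non-negative numbers. The background process $(J_t)$ is the continuous-time Markov chain on $\{1,\dots,d\}$ with transition rate matrix $q\,\boldsymbol{1}\boldsymbol{\pi}-qI_d$ ($\boldsymbol{1}$ the all-ones column vector, $I_d$ the identity matrix). Equivalently: after i.i.d. exponentially distributed times with mean $q^{-1}$, the pair of arrival rate and service rate is resampled, independently of everything else, from the law of $(\Lambda,\mathcal{M})$, which takes the value $(\lambda_i,\mu_i)$ with probability $\pi_i$ ($\Lambda$ and $\mathcal{M}$ may be dependent). When the background state is $i$, customers arrive at Poisson rate $\lambda_i$ and the single server works at exponential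 rate $\mu_i$: the pair (queue length, background state) moves $(k,i)\to(k+1,i)$ at rate $\lambda_i$ and $(k,i)\to(k-1,i)$ at rate $\mu_i$ when $k\ge1$. $Q$ is the steady-state number of customers. $\mathbb{E}\Lambda=\sum_i\pi_i\lambda_i$, $\mathbb{E}\mathcal{M}=\sum_i\pi_i\mu_i>0$, and similarly for variances and the covariance. The load is $\rho:=\mathbb{E}\Lambda/\mathbb{E}\mathcal{M}$. Heavy-traffic regime. $\boldsymbol{\pi}$, $q$ and the $\mu_i$ are kept fixed, and $\lambda_i=c\,\lambda_{0,i}$ for fixed $\lambda_{0,i}\ge0$ with $\rho_0:=\sum_i\pi_i\lambda_{0,i}/\sum_i\pi_i\mu_i\in(0,1)$; thus $\rho=c\rho_0$ and $\rho\uparrow1$ means $c\uparrow\rho_0^{-1}$. In the limit, $\lambda_i=\lambda_{0,i}/\rho_0$. *)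

(* Defs.v *)
From HB Require Import structures.
From mathcomp Require Import all_boot all_order all_algebra.
From mathcomp Require Import all_classical all_reals all_analysis.

Set Implicit Arguments.
Unset Strict Implicit.
Unset Printing Implicit Defensive.

Import Order.TTheory GRing.Theory Num.Theory.
Import numFieldNormedType.Exports.

Local Open Scope classical_set_scope.
Local Open Scope ring_scope.

Section moments.
Context {R : realType} {d : nat}.
Implicit Types (p : 'rV[R]_d) (f g : 'I_d -> R).

Definition mean p f : R := \sum_i p 0 i * f i.

Definition cov p f g : R :=
  mean p (fun i => (f i - mean p f) * (g i - mean p g)).

Definition var p f : R := cov p f f.

Definition load p (lambda mu : 'I_d -> R) : R := mean p lambda / mean p mu.

Definition sigma2 p (q : R) (lambda mu : 'I_d -> R) : R :=
  (var p lambda - 2 * cov p lambda mu + var p mu) * (2 / q) + 2 * mean p mu.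

End moments.

Section resampled_queue.
Context {R : realType} {d : nat}.

Definition background_generator (p : 'rV[R]_d) (q : R) : 'M[R]_d :=
  q *: ((const_mx 1 : 'cV[R]_d) *m p) - q%:M.

(* Only the values at x != y are meaningful (and used): they are the off-diagonal
   entries of the generator of the pair (queue length, background state). *)
Definition queue_rate (p : 'rV[R]_d) (q : R) (lambda mu : 'I_d -> R)
    (x y : nat * 'I_d) : R :=
  if x.2 == y.2 then
    if y.1 == x.1.+1 then lambda x.2
    else if x.1 == y.1.+1 then mu x.2
    else 0
  else if x.1 == y.1 then background_generator p q x.2 y.2
  else 0.

End resampled_queue.

(* [m] is a stationary distribution (given by its probability mass function) of
   the Markov chain on S with transition rates [rate x y], x != y: the last
   clause is global balance, flux into y = flux out of y. *)
Definition stationary {R : realType} {S : choiceType} (rate : S -> S -> R)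
    (m : S -> \bar R) : Prop :=
  [/\ forall x, (0 <= m x)%E,
      (\esum_(x in [set: S]) m x = 1)%E &
      forall y, (\esum_(x in [set~ y]) (m x * (rate x y)%:E) =
                 m y * \esum_(x in [set~ y]) (rate y x)%:E)%E].

(* ['I_d] carries no [measurableType] structure (it may be empty), so that [J] is
   a random variable is stated through its fibres. *)
Definition steady_state {R : realType} {d : nat} {disp}
    {T : measurableType disp} (P : probability T R)
    (rate : nat * 'I_d -> nat * 'I_d -> R)
    (Q : {RV P >-> nat}) (J : T -> 'I_d) : Prop :=
  (forall i, measurable (J @^-1` [set i])) /\
  stationary rate (fun s => P [set w | (Q w, J w) = s]).

Section scaled_queue_length.
Context {R : realType} {disp : measure_display} {T : measurableType disp}.

Definition scaled_queue_length (a : R) (Q : {mfun T >-> nat}) : T -> R :=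
  fun w => a * (Q w)%:R.

Lemma measurable_scaled_queue_length a Q :
  measurable_fun [set: T] (scaled_queue_length a Q).
Proof.
exact: (@measurableT_comp _ _ _ _ _ _ (fun n : nat => a * n%:R : R)).
Qed.

HB.instance Definition _ a Q := isMeasurableFun.Build _ _ _ _
  (scaled_queue_length a Q) (measurable_scaled_queue_length a Q).

End scaled_queue_length.

(* The variables [Y i] may live on different probability spaces.  The test is at
   the continuity points of the limiting distribution function. *)
Definition converges_in_distribution {R : realType} {I : Type}
    (F : set_system I) {disp : I -> measure_display}
    {T : forall i, measurableType (disp i)}
    (P : forall i, probability (T i) R) (Y : forall i, {RV P i >-> R})
    (nu : set R -> \bar R) : Prop :=
  forall x : R, {for x, continuous (fun y : R => nu `]-oo, y]%classic)} ->
    cdf (Y i) x @[i --> F] --> nu `]-oo, x]%classic.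

(* Main.v *)
Require Import Defs.
From HB Require Import structures.
From mathcomp Require Import all_boot all_order all_algebra.
From mathcomp Require Import all_classical all_reals all_analysis.
From mathcomp Require Import measurable_realfun.
From mathcomp Require Import ring lra.

Set Implicit Arguments.
Unset Strict Implicit.
Unset Printing Implicit Defensive.

Import Order.TTheory GRing.Theory Num.Theory.
Import numFieldNormedType.Exports.

Local Open Scope classical_set_scope.
Local Open Scope ring_scope.

(* With G_i(z) = E[z^Q; J = i] and s = 1/z - 1, global balance reads
   G_i (q - s v_i) = q p_i G - s mu_i P(Q = 0, J = i), where G = sum_i G_i and
   v_i = mu_i - lambda_i z, while the balance of the flows across each queue
   length gives sum_i G_i v_i = sum_i mu_i P(Q = 0, J = i) = (1 - rho) E M.
   Eliminating the G_i leaves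
     G (sum_i p_i v_i + s sum_i p_i v_i^2 / (q - s v_i)) =
       (1 - rho) E M + s sum_i mu_i P(Q = 0, J = i) v_i / (q - s v_i).
   Put z = exp (- n (1 - rho)), so that s / (1 - rho) tends to n.  After division
   by 1 - rho the last sum vanishes in the limit and the n-th Laplace transform of
   (1 - rho) Q tends to E M / (E M + n sigma^2 / 2), that of the exponential law.
   The values at the natural numbers n suffice: they are the moments of
   exp (- (1 - rho) Q), a variable with values in [0, 1]. *)

(** * Convergence in distribution from Laplace transforms *)

Lemma cvg_sumr {R : realType} {I J : Type} (F : set_system I) {FF : Filter F}
    (r : seq J) (f : J -> I -> R) (l : J -> R) :
  (forall j, f j x @[x --> F] --> l j) ->
  \sum_(j <- r) f j x @[x --> F] --> \sum_(j <- r) l j.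
Proof.
move=> fl; elim: r => [|j r IH].
  by under eq_fun do rewrite big_nil; rewrite big_nil; exact: cvg_cst.
by under eq_fun do rewrite big_cons; rewrite big_cons; exact: cvgD.
Qed.

Section cutoff.
Context {R : realType}.

(* With N close to exp(m t), the factor (1 - exp(-m y))^N is close to 1 when y > t
   and to 0 when y < t: it is at least 1 - N exp(-m y) and at most
   1 / (1 + N exp(-m y)). *)
Definition cutoff (m N : nat) : {poly R} := 1 - (1 - 'X^m) ^+ N.

Lemma horner_cutoff m N (x : R) :
  (cutoff m N).[x] = 1 - (1 - x ^+ m) ^+ N.
Proof. by rewrite /cutoff !hornerE. Qed.

Lemma bernoulli_ler (x : R) N : 0 <= x <= 1 -> 1 - N%:R * x <= (1 - x) ^+ N.
Proof.
move=> /andP[x0 x1]; elim: N => [|N IH]; first by rewrite mul0r subr0 expr0.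
rewrite exprS; have N0 : 0 <= N%:R :> R by [].
apply: (@le_trans _ _ ((1 - x) * (1 - N%:R * x))).
  rewrite -natr1; have : 0 <= N%:R * (x * x) by rewrite !mulr_ge0.
  lra.
by rewrite ler_wpM2l// subr_ge0.
Qed.

(** By induction, since (1 + (N + 1) x) (1 - x) = 1 + N x - (N + 1) x ^ 2 is at most 1 + N x. *)
Lemma bernoulli_ger (x : R) N : 0 <= x <= 1 ->
  (1 + N%:R * x) * (1 - x) ^+ N <= 1.
Proof.
move=> /andP[x0 x1]; elim: N => [|N IH]; first by rewrite mul0r addr0 expr0 mulr1.
apply: le_trans IH; rewrite exprS mulrA ler_wpM2r ?exprn_ge0 ?subr_ge0//.
have N0 : 0 <= N%:R :> R by [].
have : 0 <= N%:R * (x * x) by rewrite !mulr_ge0.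
by rewrite -natr1; nra.
Qed.

(** For y <= t - eta, 1 + N exp (- m y) is at least exp (m eta); for y >= t + eta, N exp (- m y) is
    at most exp (- m eta). The two Bernoulli bounds turn both into an error of at most exp (- m
    eta), so one large m serves both sides. *)
Lemma cutoffP (t eta e : R) : 0 < eta -> 0 < e -> exists p : {poly R},
  forall y, 0 <= y ->
  [/\ 0 <= p.[expR (- y)] <= 1, y <= t - eta -> 1 - e <= p.[expR (- y)] &
      t + eta <= y -> p.[expR (- y)] <= e].
Proof.
move=> eta0 e0.
have [m me] : exists m : nat, expR (- (m%:R * eta)) <= e.
  (* This choice gives 1 / e <= m eta <= exp (m eta). *)
  exists (Num.bound (e^-1 / eta)); set m := Num.bound _.
  rewrite expRN -[leRHS]invrK lef_pV2 ?posrE ?expR_gt0 ?invr_gt0//.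
  have : e^-1 <= m%:R * eta.
    by rewrite -ler_pdivrMr// ltW// archi_boundP// divr_ge0 ?invr_ge0// ltW.
  by move/le_trans; apply; rewrite (le_trans _ (expR_ge1Dx _))// lerDr.
pose N := Num.truncn (expR (m%:R * t)).
have /andP[N1 N2] : N%:R <= expR (m%:R * t) < N.+1%:R by rewrite truncn_itv// expR_ge0.
exists (cutoff m N) => y y0; rewrite !horner_cutoff.
have E : expR (- y) ^+ m = expR (- (m%:R * y)) by rewrite -expRM_natl mulrN.
rewrite E; set x := expR _.
have x0 : 0 <= x by exact: expR_ge0.
have x1 : x <= 1 by rewrite /x -expR0 ler_expR oppr_le0 mulr_ge0.
have x01 : 0 <= x <= 1 by rewrite x0.
have b0 : 0 <= (1 - x) ^+ N by rewrite exprn_ge0// subr_ge0.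
have b1 : (1 - x) ^+ N <= 1 by rewrite exprn_ile1 ?subr_ge0// gerBl.
split.
- by rewrite subr_ge0 b1 gerBl.
- move=> yt; rewrite lerD2l lerN2; apply: le_trans me.
  (* Rounding exp (m t) down to N loses at most one x <= 1, which the leading 1 absorbs. *)
  have Nx : expR (m%:R * eta) <= 1 + N%:R * x.
    apply: (@le_trans _ _ (N.+1%:R * x)); last by rewrite -natr1 mulrDl mul1r; lra.
    apply: (@le_trans _ _ (expR (m%:R * t) * x)); last by rewrite ler_wpM2r// ltW.
    rewrite /x -expRD ler_expR -mulrN -mulrDr ler_wpM2l//; lra.
  rewrite expRN -[leRHS]mul1r ler_pdivlMr ?expR_gt0// mulrC.
  by apply: le_trans (bernoulli_ger N x01); rewrite ler_wpM2r.
- move=> ty; apply: le_trans me.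
  rewrite lerBlDr -lerBlDl; apply: le_trans (bernoulli_ler N x01).
  rewrite lerD2l lerN2.
  apply: (@le_trans _ _ (expR (m%:R * t) * x)); first by rewrite ler_wpM2r.
  rewrite /x -expRD ler_expR -!mulrN -mulrDr ler_wpM2l//; lra.
Qed.

End cutoff.

Section laplace_continuity.
Context {R : realType}.

Lemma integrable_horner_expR d (T : measurableType d) (P : probability T R)
    (Y : {RV P >-> R}) (p : {poly R}) : (forall w, 0 <= Y w) ->
  P.-integrable [set: T] (EFin \o (fun w => p.[expR (- Y w)])).
Proof.
move=> Y0.
have e1 w : `|expR (- Y w)| <= 1.
  by rewrite ger0_norm ?expR_ge0// -expR0 ler_expR oppr_le0.
have mp : measurable_fun [set: T] (fun w => p.[expR (- Y w)]).
  have -> : (fun w => p.[expR (- Y w)]) =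
      (fun w => \sum_(i < size p) p`_i * expR (- Y w) ^+ i).
    by apply/funext => w; rewrite horner_coef.
  apply: measurable_sum => i; apply: measurable_funM => //.
  by apply: measurable_funX; apply: measurableT_comp => //; exact: measurable_funN.
apply: measurable_bounded_integrable => //.
  by rewrite -ge0_fin_numE// fin_num_measure.
exists (\sum_(i < size p) `|p`_i|); split; first by rewrite num_real.
move=> M HM w _ /=; apply: le_trans (ltW HM).
rewrite horner_coef (le_trans (ler_norm_sum _ _ _))// ler_sum// => i _.
by rewrite normrM ler_piMr// normrX exprn_ile1.
Qed.

Lemma Rintegral_horner_expR d (T : measurableType d) (P : probability T R)
    (Y : {RV P >-> R}) (p : {poly R}) : (forall w, 0 <= Y w) ->
  \int[P]_w p.[expR (- Y w)] =
  \sum_(i < size p) p`_i * \int[P]_w expR (- Y w) ^+ i.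
Proof.
move=> Y0; rewrite /Rintegral.
under eq_integral do rewrite horner_coef -sumEFin.
have iX i : P.-integrable setT (EFin \o (fun w => expR (- Y w) ^+ i)).
  have := integrable_horner_expR ('X^i) Y0.
  by apply: eq_integrable => // w _ /=; rewrite hornerXn.
rewrite integral_sum//=; last first.
  move=> i; have := integrableZl measurableT p`_i (iX i).
  by apply: eq_integrable.
rewrite -sum_fine; last first.
  move=> i _; apply: integrable_fin_num => //.
  have := integrableZl measurableT p`_i (iX i).
  by apply: eq_integrable.
by apply: eq_bigr => i _; rewrite -/(Rintegral _ _ _) RintegralZl.
Qed.

(** Integrates the pointwise bounds of [cutoffP] against indicators. The polynomial is chosen before
    the probability space, so that one p serves every [Y i] and the limit alike. *)
Lemma cutoff_cdf (t eta e : R) : 0 < eta -> 0 < e -> exists p : {poly R},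
  forall d (T : measurableType d) (P : probability T R) (Y : {RV P >-> R}),
  (forall w, 0 <= Y w) ->
  fine (cdf Y (t - eta)) - e <= \int[P]_w p.[expR (- Y w)] /\
  \int[P]_w p.[expR (- Y w)] <= fine (cdf Y (t + eta)) + e.
Proof.
move=> eta0 e0; have [p hp] := cutoffP t eta0 e0; exists p => d T P Y Y0.
have mA s : measurable (Y @^-1` `]-oo, s]) by exact: measurable_funPTI.
have cdfE s k : fine (cdf Y s) + k = \int[P]_w (\1_(Y @^-1` `]-oo, s]) w + k).
  rewrite RintegralD//; last 2 first.
  - exact: integrable_indic.
  - exact: finite_measure_integrable_cst.
  rewrite Rintegral_cst// (_ : fine (P [set: T]) = 1) ?mulr1; last first.
    by rewrite (@probability_setT _ _ _ P).
  congr (_ + _).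
  by rewrite /Rintegral integral_indic// setIT.
have ii s k : P.-integrable setT
    (EFin \o (fun w => \1_(Y @^-1` `]-oo, s]) w + k)).
  apply: (eq_integrable measurableT
    ((EFin \o \1_(Y @^-1` `]-oo, s])) \+ cst k%:E)%E) => //.
  apply: integrableD => //; first exact: integrable_indic.
  exact: finite_measure_integrable_cst.
have indE s w : \1_(Y @^-1` `]-oo, s]) w = (Y w <= s)%R%:R :> R.
  by rewrite indicE; congr (nat_of_bool _)%:R; apply/idP/idP;
    rewrite inE/= in_itv.
split; rewrite cdfE; apply: le_Rintegral => //; try exact: integrable_horner_expR.
- move=> w _; rewrite indE; have [/andP[h0 h1] hl _] := hp _ (Y0 w).
  have [h|h] := boolP (Y w <= _); first exact: hl.
  by rewrite add0r (le_trans _ h0)// oppr_le0 ltW.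
- move=> w _; rewrite indE; have [/andP[h0 h1] _ hr] := hp _ (Y0 w).
  have [h|] := boolP (Y w <= _); first by rewrite (le_trans h1)// lerDl ltW.
  by rewrite -ltNge add0r => /ltW/hr.
Qed.

(** Expectations of polynomials in exp (- Y) are finite combinations of the given transforms, hence
    converge, and cutoff polynomials trap the distribution functions between such expectations. *)
Lemma laplace_converges_in_distribution {I : Type} (F : set_system I)
    {FF : Filter F} (disp : I -> measure_display)
    (T : forall i, measurableType (disp i)) (P : forall i, probability (T i) R)
    (Y : forall i, {RV P i >-> R}) d0 (T0 : measurableType d0)
    (P0 : probability T0 R) (X : {RV P0 >-> R}) :
  (\forall i \near F, forall w, 0 <= Y i w) -> (forall w, 0 <= X w) ->
  (forall n : nat, \int[P i]_w expR (- Y i w) ^+ n @[i --> F] -->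
                   \int[P0]_w expR (- X w) ^+ n) ->
  forall x, {for x, continuous (cdf X)} -> cdf (Y i) x @[i --> F] --> cdf X x.
Proof.
move=> Y0 X0 LT x cx.
have Lp (p : {poly R}) : \int[P i]_w p.[expR (- Y i w)] @[i --> F] -->
    \int[P0]_w p.[expR (- X w)].
  rewrite Rintegral_horner_expR//; apply: (@cvg_trans _
    (\sum_(k < size p) p`_k * \int[P i]_w expR (- Y i w) ^+ k @[i --> F]));
    last by apply: cvg_sumr => k; apply: cvgM; [exact: cvg_cst | exact: LT].
  apply: near_eq_cvg; near=> i; rewrite Rintegral_horner_expR//.
  by near: i.
have fincdf d (S : measurableType d) (Q : probability S R) (Z : {RV Q >-> R}) s :
    cdf Z s \is a fin_num by exact: fin_num_measure.
rewrite -(fineK (fincdf _ _ _ X x)); apply/fine_cvgP; split.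
  by apply: nearW => i.
apply/cvgrPdist_le => /= e e0.
(* On each side the error has four sources: the cutoff for [Y i], the cutoff for [X], the
   convergence of expectations, and the continuity of [cdf X] at x. *)
have e40 : 0 < e / 4 by rewrite divr_gt0.
have : fine (cdf X y) @[y --> x] --> fine (cdf X x).
  by apply: fine_cvg; rewrite fineK.
move=> /cvgrPdist_le /(_ _ e40) /nbhs_ballP[/= r r0 hr].
(* The points x - 2 eta and x + 2 eta must lie strictly inside the ball of radius r. *)
pose eta := r / 3.
have eta0 : 0 < eta by rewrite divr_gt0.
(* [p1] drops between x and x + 2 eta and bounds [cdf (Y i) x] from above; [p2] drops between x - 2
   eta and x and bounds it from below. *)
have [p1 hp1] := cutoff_cdf (x + eta) eta0 e40.
have [p2 hp2] := cutoff_cdf (x - eta) eta0 e40.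
have {hr} hr s : `|s - x| <= 2 * eta -> `|fine (cdf X x) - fine (cdf X s)| <= e / 4.
  move=> h; apply: hr; rewrite /ball/= distrC (le_lt_trans h)// /eta; lra.
have /hr : `|x + eta + eta - x| <= 2 * eta by rewrite ger0_norm; lra.
have /hr : `|x - eta - eta - x| <= 2 * eta by rewrite ler0_norm; lra.
rewrite !ler_norml => /andP[a1 a2] /andP[b1 b2].
near=> i.
have Yi : forall w, 0 <= Y i w by near: i.
have [_ c2] := hp1 _ _ _ X X0.
have [d1 _] := hp1 _ _ _ (Y i) Yi.
have [c3 _] := hp2 _ _ _ X X0.
have [_ d4] := hp2 _ _ _ (Y i) Yi.
rewrite addrK in d1; rewrite subrK in d4.
have : `|\int[P0]_w p1.[expR (- X w)] - \int[P i]_w p1.[expR (- Y i w)]| <= e / 4.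
  by near: i; move/cvgrPdist_le : (Lp p1); exact.
have : `|\int[P0]_w p2.[expR (- X w)] - \int[P i]_w p2.[expR (- Y i w)]| <= e / 4.
  by near: i; move/cvgrPdist_le : (Lp p2); exact.
rewrite !ler_norml => /andP[f1 f2] /andP[g1 g2].
by apply/andP; split => /=; lra.
Unshelve. all: by end_near. Qed.

End laplace_continuity.

(** * Laplace transform of the exponential law *)

Section exponential.
Context {R : realType}.

(* The probability structure of [exponential_prob a] takes a proof of [0 < a] that
   unification cannot guess. *)
Lemma exponential_probability (a : R) : 0 < a ->
  exists P : probability (measurableTypeR R) R,
    (P : set R -> \bar R) = exponential_prob a.
Proof.
move=> a0.
by unshelve refine
  (ex_intro _ (exponential_prob a : probability (measurableTypeR R) R) _).
Qed.

(** [P] is absolutely continuous, and its Radon-Nikodym derivative equals g almost everywhere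
    because both have the same integral over every measurable set. *)
Lemma integral_density (P : probability (measurableTypeR R) R) (g : R -> R)
    (f : R -> \bar R) :
  (lebesgue_measure : measure (measurableTypeR R) R).-integrable
    [set: measurableTypeR R] (EFin \o g) ->
  (forall A, measurable A ->
     P A = (\int[lebesgue_measure]_(x in A) (g x)%:E)%E) ->
  P.-integrable [set: R] f ->
  (\int[P]_x f x = \int[lebesgue_measure]_x (f x * (g x)%:E))%E.
Proof.
move=> ig Pg intf.
have dom : P `<< (lebesgue_measure : measure (measurableTypeR R) R).
  apply/null_content_dominatesP => A mA A0; rewrite Pg//.
  apply: null_set_integral => //.
  by apply: measurable_funTS; exact: measurable_int ig.
rewrite -(Radon_Nikodym_change_of_variables dom)//.
apply: ae_eq_integral => //.
- apply: emeasurable_funM => //; first exact: measurable_int intf.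
- apply: emeasurable_funM => //; first exact: measurable_int intf.
  exact: measurable_int ig.
- apply: ae_eqe_mul2l.
  apply: integral_ae_eq => //.
  + by apply: Radon_Nikodym_integrable; exact: dom.
  + exact: measurable_int ig.
  + by move=> A _ mA; rewrite -Radon_Nikodym_integral//= Pg.
Qed.

(* The continuity theorem above asks for a nonnegativity that holds everywhere, so the
   exponential law is realized by the positive part rather than by the identity. *)
Let pos_part : measurableTypeR R -> R := fun x => Num.max x 0.

Let measurable_pos_part : measurable_fun [set: measurableTypeR R] pos_part.
Proof. exact: measurable_maxr. Qed.

HB.instance Definition _ :=
  isMeasurableFun.Build _ _ _ _ pos_part measurable_pos_part.

(** Multiplying the density of rate a by exp (- n x) gives a / (a + n) times the density of rate a +
    n, which has total mass 1. *)
Lemma exponential_laplace (a : R) (P : probability (measurableTypeR R) R) n :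
  0 < a -> (P : set R -> \bar R) = exponential_prob a ->
  \int[P]_x expR (- pos_part x) ^+ n = a / (a + n%:R).
Proof.
move=> a0 PE; have an0 : 0 < a + n%:R by rewrite ltr_wpDr.
rewrite /Rintegral (integral_density (g := exponential_pdf a)); last 3 first.
- exact: integrable_exponential_pdf.
- by move=> A mA; rewrite PE.
- have := @integrable_horner_expR _ _ _ P pos_part 'X^n.
  by under eq_fun do rewrite hornerXn; apply => x; rewrite le_max lexx orbT.
transitivity (fine (\int[lebesgue_measure]_x ((a / (a + n%:R))%:E *
    (exponential_pdf (a + n%:R) x)%:E)%E)); last first.
  rewrite ge0_integralZl//; last 3 first.
  - by apply/measurable_EFinP; exact: measurable_exponential_pdf.
  - by move=> x _; rewrite lee_fin exponential_pdf_ge0// ltW.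
  - by rewrite lee_fin divr_ge0// ltW.
  by rewrite integral_exponential_pdf// mule1.
congr fine; apply: eq_integral => x _; rewrite -!EFinM; congr (_%:E).
have [x0|x0] := leP 0 x; last by rewrite !lt0_exponential_pdf// !mulr0.
rewrite !exponential_pdfE// [RHS]mulrA divfK ?gt_eqF//.
rewrite /pos_part max_l// -expRM_natl mulrCA -expRD; congr (_ * expR _).
by rewrite -mulr_natl; ring.
Qed.

(** Taking the positive part matters only for y < 0, where the preimage is empty and the exponential
    density vanishes. *)
Lemma cdf_pos_part (a : R) (P : probability (measurableTypeR R) R) :
  0 < a -> (P : set R -> \bar R) = exponential_prob a ->
  cdf (pos_part : {RV P >-> R}) = fun y => exponential_prob a `]-oo, y].
Proof.
move=> a0 PE; apply/funext => y; rewrite /cdf/= /distribution/= /pushforward/=.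
have [y0|y0] := leP 0 y.
  rewrite -PE; congr (P _); apply/seteqP; split => x/=;
  by rewrite !in_itv/= /pos_part ge_max y0 andbT.
rewrite (_ : _ @^-1` _ = set0); last first.
  apply/seteqP; split => x//=; rewrite in_itv/= /pos_part ge_max.
  by rewrite leNgt (leNgt 0) y0 andbF.
rewrite measure0 /exponential_prob integral0_eq// => x /=.
rewrite in_itv/= => xy; rewrite lt0_exponential_pdf//.
exact: le_lt_trans xy y0.
Qed.

Lemma laplace_converges_exponential {I : Type} (F : set_system I)
    {FF : Filter F} (disp : I -> measure_display)
    (T : forall i, measurableType (disp i)) (P : forall i, probability (T i) R)
    (Y : forall i, {RV P i >-> R}) (a : R) : 0 < a ->
  (\forall i \near F, forall w, 0 <= Y i w) ->
  (forall n : nat, \int[P i]_w expR (- Y i w) ^+ n @[i --> F] --> a / (a + n%:R)) ->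
  converges_in_distribution F Y (exponential_prob a).
Proof.
move=> a0 Y0 LT x cx; have [P0 PE] := exponential_probability a0.
have E := cdf_pos_part a0 PE.
have := @laplace_converges_in_distribution R I F FF disp T P Y _ _ P0 pos_part Y0.
rewrite E; apply => //.
- by move=> w; rewrite le_max lexx orbT.
- by move=> n; rewrite (exponential_laplace _ a0 PE).
Qed.

End exponential.

(** * Balance equations and generating functions *)

(** Reduces the fluxes in global balance, sums over all states, to finite sums over the states one
    jump away. *)
Lemma esum_seq {R : realType} {S : choiceType} (D : set S) (r : seq S)
    (f : S -> \bar R) : uniq r -> (forall x, (0 <= f x)%E) ->
  (forall x, x \in r -> D x) -> (forall x, D x -> x \notin r -> f x = 0%E) ->
  (\esum_(x in D) f x = \sum_(x <- r) f x)%E.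
Proof.
move=> ur f0 rD Dr; rewrite fsbig_seq// -esum_fset//.
rewrite esum_mkcond [RHS]esum_mkcond; apply: eq_esum => x _.
have [xr|xr] := boolP (x \in r); first by rewrite !mem_set//=; exact: rD.
rewrite [in RHS]memNset/=; last by apply/negP.
by case: ifPn => // /set_mem xD; rewrite Dr.
Qed.

Section balance.
Context {R : realType} {d : nat} (p : 'rV[R]_d) (q : R) (lambda mu : 'I_d -> R).
Hypotheses (p0 : forall i, 0 <= p 0 i) (p1 : \sum_i p 0 i = 1) (q0 : 0 < q).
Hypotheses (lambda0 : forall i, 0 <= lambda i) (mu0 : forall i, 0 <= mu i).

Lemma background_generatorE i j : i != j -> background_generator p q i j = q * p 0 j.
Proof.
move=> ij; rewrite !mxE (negbTE ij) mulr0n subr0 big_ord1.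
by rewrite !mxE mul1r.
Qed.

Lemma queue_rate_ge0 x y : 0 <= queue_rate p q lambda mu x y.
Proof.
rewrite /queue_rate; case: ifPn => [_|xy]; first by case: ifP => // _; case: ifP.
by case: ifP => // _; rewrite background_generatorE// mulr_ge0// ltW.
Qed.

(** Contains every state with a nonzero rate to or from (k, i), so that one list serves both sides
    of global balance. The match drops the downward neighbour when the queue is empty. *)
Definition neighbours (k : nat) (i : 'I_d) : seq (nat * 'I_d) :=
  (k.+1, i) :: (if k is k'.+1 then [:: (k', i)] else [::]) ++
  [seq (k, j) | j <- [seq j <- enum 'I_d | j != i]].

Lemma uniq_neighbours k i : uniq (neighbours k i).
Proof.
have um : uniq [seq (k, j) | j <- [seq j <- enum 'I_d | j != i]].
  by rewrite map_inj_uniq ?filter_uniq -?enumT ?enum_uniq// => a b [].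
have nm l : l != k -> (l, i) \notin [seq (k, j) | j <- [seq j <- enum 'I_d | j != i]].
  by move=> lk; apply/mapP => -[j _ [/eqP]]; rewrite (negbTE lk).
rewrite /neighbours; case: k um nm => [|k] um nm /=.
  by rewrite nm.
rewrite um !inE negb_or xpair_eqE !nm ?neq_ltn ?ltnS ?leqnn ?orbT//.
by rewrite gtn_eqF// ltnW.
Qed.

Lemma mem_neighbours k i x : x \in neighbours k i =
  [|| x == (k.+1, i), (x.1.+1 == k) && (x.2 == i) | (x.1 == k) && (x.2 != i)].
Proof.
rewrite /neighbours inE mem_cat; congr [|| _, _ | _].
  case: k x => [|k] [l j]; first by rewrite inE.
  by rewrite inE xpair_eqE eqSS.
case: x => l j /=; apply/mapP/andP => [[b]|[/eqP-> ji]].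
  by rewrite mem_filter => /andP[bi _] [-> ->].
by exists j => //; rewrite mem_filter ji mem_enum.
Qed.

Lemma queue_rate_neighbours0 k i x : x \notin neighbours k i -> x <> (k, i) ->
  queue_rate p q lambda mu x (k, i) = 0 /\ queue_rate p q lambda mu (k, i) x = 0.
Proof.
rewrite mem_neighbours; case: x => l j; rewrite /queue_rate/= !xpair_eqE.
rewrite [(i == j)]eq_sym; have [->|ji] := eqVneq j i; rewrite ?andbT ?andbF ?orbF/=.
  by rewrite negb_or [(k == l.+1)]eq_sym => /andP[/negbTE-> /negbTE->].
by rewrite [(k == l)]eq_sym => /negbTE ->.
Qed.

(** Resampling leaves state i at rate q (1 - p_i) only; adding q p_i u_i to both sides, as if
    resampling to the same state were a jump, gives outflow q and an inflow that involves the full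
    sum over j. The factor (0 < k) switches off service and arrivals from below at k = 0, where
    [k.-1] is a default value. *)
Lemma global_balance (u : 'I_d -> nat -> R) (m : nat * 'I_d -> \bar R) :
  (forall i k, m (k, i) = (u i k)%:E) -> stationary (queue_rate p q lambda mu) m ->
  forall i k, u i k * (lambda i + (0 < k)%N%:R * mu i + q) =
    (0 < k)%N%:R * u i k.-1 * lambda i + u i k.+1 * mu i + q * p 0 i * \sum_j u j k.
Proof.
move=> mu_ [m0 m1 bal] i k.
have D x : x \in neighbours k i -> [set~ (k, i)] x.
  rewrite mem_neighbours => + xk; rewrite xk/= !xpair_eqE !eqxx/= !andbT orbF.
  by rewrite ltn_eqF// gtn_eqF.
have := bal (k, i).
rewrite (esum_seq (uniq_neighbours k i) _ D); last 2 first.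
- by move=> x; rewrite mule_ge0// lee_fin queue_rate_ge0.
- by move=> x xk xn; have [-> _] := queue_rate_neighbours0 xn xk; rewrite mule0.
rewrite (esum_seq (uniq_neighbours k i) _ D); last 2 first.
- by move=> x; rewrite lee_fin queue_rate_ge0.
- by move=> x xk xn; have [_ ->] := queue_rate_neighbours0 xn xk.
have bigN (f : 'I_d -> R) : \sum_(x <- [seq j <- enum 'I_d | j != i]) f x =
    \sum_j f j - f i.
  by rewrite big_filter big_enum_cond [in RHS](bigD1 i)//= addrAC subrr add0r.
have E : (\sum_(x <- neighbours k i) (m x * (queue_rate p q lambda mu x (k, i))%:E) =
    (u i k.+1 * mu i + ((0 < k)%N%:R * u i k.-1 * lambda i +
      q * p 0 i * (\sum_j u j k - u i k)))%:E)%E.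
  rewrite /neighbours big_cons big_cat big_map/=.
  under [X in (_ + (_ + X))%E]eq_big_seq => j.
    rewrite mem_filter => /andP[ji _]; rewrite mu_ /queue_rate/= (negbTE ji) eqxx.
    rewrite background_generatorE// -EFinM; over.
  rewrite sumEFin bigN mu_ /queue_rate/= eqxx (ltn_eqF (ltnW _))// eqxx -EFinM.
  rewrite -mulr_suml -mulrBl.
  case: k {D m1 bal} => [|k] /=.
    by rewrite big_nil -!EFinD !mul0r mulrC [in RHS](mulrC _ (_ - _)).
  rewrite big_seq1 mu_ /= eqxx eqxx -EFinM -!EFinD mul1r.
  by rewrite [in RHS](mulrC _ (_ - _)).
rewrite {}E.
have E : (\sum_(x <- neighbours k i) (queue_rate p q lambda mu (k, i) x)%:E =
    (lambda i + ((0 < k)%N%:R * mu i + q * (1 - p 0 i)))%:E)%E.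
  rewrite /neighbours big_cons big_cat big_map/=.
  under [X in (_ + (_ + X))%E]eq_big_seq => j.
    rewrite mem_filter eq_sym => /andP[ji _]; rewrite /queue_rate/= (negbTE ji) eqxx.
    rewrite background_generatorE//; over.
  rewrite [X in (_ + (_ + X))%E]sumEFin bigN -mulr_sumr p1 /queue_rate/= !eqxx.
  case: k {D m1 bal} => [|k] /=.
    by rewrite big_nil -!EFinD mul0r mulrBr mulr1.
  rewrite big_seq1 /= eqxx eqxx (ltn_eqF (ltnW _))// -!EFinD mul1r.
  by rewrite mulrBr mulr1.
rewrite {}E mu_ -EFinM => -[] H.
lra.
Qed.

End balance.

(** * Generating functions of solutions of the balance equations *)

Section generating_function.
Context {R : realType} {d : nat} (p : 'rV[R]_d) (q : R) (lambda mu : 'I_d -> R).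
Variable u : 'I_d -> nat -> R.
Hypothesis u_ge0 : forall i k, 0 <= u i k.
Hypothesis u_le1 : forall i N, \sum_(k < N) u i k <= 1.
Hypothesis balance : forall i k,
  u i k * (lambda i + (0 < k)%N%:R * mu i + q) =
  (0 < k)%N%:R * u i k.-1 * lambda i + u i k.+1 * mu i + q * p 0 i * \sum_j u j k.
Hypotheses (q0 : 0 < q) (p1 : \sum_i p 0 i = 1).

(** Identities between generating functions are proved by induction for these partial sums, with
    shifted truncations, and then passed to the limit. *)
Definition gf_part (z : R) i N := \sum_(k < N) z ^+ k * u i k.

Definition gf (z : R) i := limn (gf_part z i).

Lemma cvg_gf z i : 0 < z <= 1 -> gf_part z i N @[N --> \oo] --> gf z i.
Proof.
move=> /andP[z0 z1]; apply: nondecreasing_is_cvgn.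
  apply/nondecreasing_seqP => N; rewrite /gf_part big_ord_recr/= lerDl.
  by rewrite mulr_ge0// exprn_ge0// ltW.
exists 1 => _ [N _ <-]; apply: le_trans (u_le1 i N).
by apply: ler_sum => k _; rewrite ler_piMl// exprn_ile1// ltW.
Qed.

Lemma cvg_gfS z i : 0 < z <= 1 -> gf_part z i N.+1 @[N --> \oo] --> gf z i.
Proof. by move=> z01; rewrite (cvg_shiftS (gf_part z i)); exact: cvg_gf. Qed.

(** Summing balance over i cancels the resampling terms, as the p_i sum to 1. The result equates the
    net flows across two consecutive cuts, and no flow crosses below level 0. *)
Lemma cut_balance k : \sum_i lambda i * u i k = \sum_i mu i * u i k.+1.
Proof.
have B k' : \sum_i (u i k' * lambda i + (0 < k')%N%:R * mu i * u i k') =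
    \sum_i ((0 < k')%N%:R * u i k'.-1 * lambda i + u i k'.+1 * mu i).
  have : \sum_i u i k' * (lambda i + (0 < k')%N%:R * mu i + q) = \sum_i
      ((0 < k')%N%:R * u i k'.-1 * lambda i + u i k'.+1 * mu i +
       q * p 0 i * \sum_j u j k') by apply: eq_bigr => i _; exact: balance.
  rewrite [RHS]big_split/= -mulr_suml -mulr_sumr p1 mulr1.
  rewrite (eq_bigr (fun i => (u i k' * lambda i + (0 < k')%N%:R * mu i * u i k') +
    q * u i k')); last by move=> i _; ring.
  by rewrite big_split/= -mulr_sumr; exact: addIr.
elim: k => [|k IH].
  have := B 0%N; rewrite (eq_bigr (fun i => lambda i * u i 0%N)) => [->|i _].
    by apply: eq_bigr => i _; rewrite /=; ring.
  by rewrite /=; ring.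
have := B k.+1; rewrite !big_split/=.
rewrite (eq_bigr (fun i => lambda i * u i k.+1)) => [|i _]; last by rewrite /=; ring.
rewrite [X in _ + X = _](eq_bigr (fun i => mu i * u i k.+1)) => [|i _];
  last by rewrite /=; ring.
rewrite [X in _ = X + _](eq_bigr (fun i => lambda i * u i k)) => [|i _]; last first.
  by rewrite /=; ring.
rewrite [X in _ = _ + X](eq_bigr (fun i => mu i * u i k.+2)) => [|i _]; last first.
  by rewrite mulrC.
by rewrite IH addrC; exact: addrI.
Qed.

(** Balance at level k is multiplied by z ^ (k + 1) and summed; the extra factor z avoids a division
    in the departure term. *)
Lemma gf_balance z i : 0 < z <= 1 ->
  z * ((lambda i + mu i + q) * gf z i - mu i * u i 0%N) =
  z * (lambda i * z * gf z i + q * p 0 i * \sum_j gf z j) + mu i * (gf z i - u i 0%N).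
Proof.
move=> z01; have zn0 : z != 0 by case/andP: z01 => /gt_eqF->.
(* Arrivals come from one level below and departures from one level above, hence the truncations N,
   N + 1 and N + 2. *)
have part N : z * ((lambda i + mu i + q) * gf_part z i N.+1 - mu i * u i 0%N) =
    z * (lambda i * z * gf_part z i N + q * p 0 i * \sum_j gf_part z j N.+1) +
    mu i * (gf_part z i N.+2 - u i 0%N).
  elim: N => [|N IH].
    rewrite /gf_part (eq_bigr (fun j => u j 0%N)); last first.
      by move=> j _; rewrite big_ord1 expr0 mul1r.
    rewrite !big_ord_recr !big_ord0/= !expr0 expr1 !add0r !mul1r.
    by have := congr1 (fun x => z * x) (balance i 0%N); rewrite /= !mul0r; lra.
  have -> : \sum_j gf_part z j N.+2 =
      \sum_j gf_part z j N.+1 + z ^+ N.+1 * \sum_j u j N.+1.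
    rewrite mulr_sumr -big_split; apply: eq_bigr => j _.
    by rewrite /gf_part big_ord_recr.
  have S3 : gf_part z i N.+3 = gf_part z i N.+2 + z * z ^+ N.+1 * u i N.+2.
    by rewrite /gf_part big_ord_recr/= -exprS.
  have S2 : gf_part z i N.+2 = gf_part z i N.+1 + z ^+ N.+1 * u i N.+1.
    by rewrite /gf_part big_ord_recr.
  have S1 : z * gf_part z i N.+1 = z * gf_part z i N + z ^+ N.+1 * u i N.
    by rewrite /gf_part big_ord_recr/= mulrDr exprS mulrA.
  (* The scaled balance equation and the scaled recursion [S1] make the induction step linear in the
     remaining monomials. *)
  have := congr1 (fun x => z * z ^+ N.+1 * x) (balance i N.+1) => /=.
  have := congr1 (fun x => z * lambda i * x) S1 => /=.
  move: IH; rewrite S3 [in X in _ -> _ -> _ -> X = _]S2.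
  move: (gf_part z i N.+2) (gf_part z i N.+1) (gf_part z i N) (\sum_j _) (\sum_j _).
  by move: (z ^+ N.+1) => a b c e f g; lra.
have L : z * ((lambda i + mu i + q) * gf_part z i N.+1 - mu i * u i 0%N)
    @[N --> \oo] --> z * ((lambda i + mu i + q) * gf z i - mu i * u i 0%N).
  by apply: cvgMr; apply: cvgB; [apply: cvgMr; exact: cvg_gfS|exact: cvg_cst].
apply: (cvg_unique (@norm_hausdorff _ _) L).
rewrite (funext part).
apply: cvgD.
  apply: cvgMr; apply: cvgD; first by apply: cvgMr; exact: cvg_gf.
  by apply: cvgMr; apply: cvg_sumr => j; exact: cvg_gfS.
apply: cvgMr; apply: cvgB; last exact: cvg_cst.
by rewrite (cvg_shiftS (fun N => gf_part z i N.+1)); exact: cvg_gfS.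
Qed.

(** [cut_balance] at level k, multiplied by z ^ (k + 1) and summed. *)
Lemma gf_cut z : 0 < z <= 1 ->
  z * \sum_i lambda i * gf z i = \sum_i mu i * (gf z i - u i 0%N).
Proof.
move=> z01.
have part N : z * \sum_i lambda i * gf_part z i N =
    \sum_i mu i * (gf_part z i N.+1 - u i 0%N).
  elim: N => [|N IH].
    rewrite !big1 ?mulr0// => i _; rewrite /gf_part ?big_ord0 ?mulr0//.
    by rewrite big_ord1 expr0 mul1r subrr mulr0.
  rewrite (eq_bigr (fun i => lambda i * gf_part z i N + z ^+ N * (lambda i * u i N)));
    last by move=> i _; rewrite /gf_part big_ord_recr/=; ring.
  rewrite big_split/= mulrDr IH -mulr_sumr cut_balance mulrA -exprS mulr_sumr.
  rewrite -big_split; apply: eq_bigr => i _.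
  by rewrite /gf_part [in RHS]big_ord_recr/=; ring.
have L : z * \sum_i lambda i * gf_part z i N @[N --> \oo] -->
    z * \sum_i lambda i * gf z i.
  by apply: cvgMr; apply: cvg_sumr => i; apply: cvgMr; exact: cvg_gf.
apply: (cvg_unique (@norm_hausdorff _ _) L).
rewrite (funext part).
apply: cvg_sumr => i; apply: cvgMr; apply: cvgB; last exact: cvg_cst.
exact: cvg_gfS.
Qed.

Hypothesis gf1 : \sum_i gf 1 i = 1.

(** At z = 1 the arrival and service terms cancel in [gf_balance]: the background state has law
    p. *)
Lemma gf1E i : gf 1 i = p 0 i.
Proof.
have /(gf_balance i) : 0 < (1 : R) <= 1 by rewrite ltr01 lexx.
rewrite gf1 => H; have : q * (gf 1 i - p 0 i) = 0 by lra.
by move=> /eqP; rewrite mulf_eq0 gt_eqF//= subr_eq0 => /eqP.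
Qed.

(** [gf_cut] at z = 1: customers enter and leave at the same mean rate. *)
Lemma idle_probability : \sum_i mu i * u i 0%N = mean p mu - mean p lambda.
Proof.
have /gf_cut : 0 < (1 : R) <= 1 by rewrite ltr01 lexx.
rewrite mul1r /mean -sumrB.
rewrite (eq_bigr (fun i => p 0 i * lambda i)); last by move=> i _; rewrite gf1E mulrC.
rewrite [X in _ = X -> _](eq_bigr (fun i => p 0 i * mu i - mu i * u i 0%N)); last first.
  by move=> i _; rewrite gf1E mulrBr mulrC.
by rewrite !sumrB => ->; rewrite opprB addrC subrK.
Qed.

Lemma gf_sum (z : R) : 0 < z <= 1 ->
  let s := z^-1 - 1 in
  let v i := mu i - lambda i * z in
  (forall i, s * v i < q) ->
  (\sum_i gf z i) * (\sum_i p 0 i * v i +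
                     s * \sum_i p 0 i * v i ^+ 2 / (q - s * v i)) =
  mean p mu - mean p lambda + s * \sum_i mu i * u i 0%N * v i / (q - s * v i).
Proof.
move=> z01 s v sv; rewrite -idle_probability.
have z0 : z != 0 by case/andP: z01 => /gt_eqF->.
have Bv : \sum_i mu i * u i 0%N = \sum_i gf z i * v i.
  apply/eqP; rewrite -subr_eq0 -sumrB; apply/eqP.
  have := gf_cut z01; rewrite mulr_sumr => /eqP; rewrite -subr_eq0 -sumrB => /eqP H.
  by apply: etrans H; apply: eq_bigr => i _; rewrite /v; ring.
(* With the idle mass replaced by the sum of the G_i v_i, the identity holds term by term in i. *)
rewrite [in RHS]Bv !mulr_sumr -!big_split/= mulr_sumr; apply: eq_bigr => i _.
have H := gf_balance i z01.
have qs : q - s * v i != 0 by rewrite subr_eq0 gt_eqF.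
(* This is [gf_balance] divided by z, using s z = 1 - z. *)
have {}H : gf z i * (q - s * v i) = q * p 0 i * (\sum_j gf z j) - s * (mu i * u i 0%N).
  apply: (mulfI z0); rewrite /s /v.
  rewrite (_ : z * (_ * _) =
    gf z i * (z * q - (1 - z) * (mu i - lambda i * z))); last by field.
  rewrite (_ : z * (_ - _) = z * q * p 0 i * (\sum_j gf z j) -
    (1 - z) * (mu i * u i 0%N)); last by field.
  lra.
set G := \sum_j _ in H *; set D := q - s * v i in qs H *.
apply: (mulfI qs).
have -> : D * (gf z i * v i + s * (mu i * u i 0%N * v i / D)) =
    (gf z i * D) * v i + s * (mu i * u i 0%N * v i) by field.
have -> : D * (G * (p 0 i * v i + s * (p 0 i * v i ^+ 2 / D))) =
    G * p 0 i * v i * (D + s * v i) by field.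
by rewrite H /D; ring.
Qed.

End generating_function.

(** * The joint law of queue length and background state *)

Section joint_distribution.
Context {R : realType} {d : nat} {disp} {T : measurableType disp}.
Variables (P : probability T R) (Q : {RV P >-> nat}) (J : T -> 'I_d).
Hypothesis measurable_J : forall i, measurable (J @^-1` [set i]).

Definition joint_pmf i k : R := fine (P [set w | (Q w, J w) = (k, i)]).

Let jointE k i : [set w | (Q w, J w) = (k, i)] = Q @^-1` [set k] `&` J @^-1` [set i].
Proof. by apply/seteqP; split => w /= [-> ->]. Qed.

Let measurable_Q k : measurable (Q @^-1` [set k]).
Proof. exact: measurable_funPTI. Qed.

Lemma measurable_joint k i : measurable [set w | (Q w, J w) = (k, i)].
Proof. by rewrite jointE; exact: measurableI. Qed.

Lemma joint_pmfE i k : P [set w | (Q w, J w) = (k, i)] = (joint_pmf i k)%:E.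
Proof. by rewrite fineK// fin_num_measure//; exact: measurable_joint. Qed.

Lemma joint_pmf_ge0 i k : 0 <= joint_pmf i k.
Proof. exact: fine_ge0. Qed.

Lemma sum_joint_pmf k : P (Q @^-1` [set k]) = (\sum_i joint_pmf i k)%:E.
Proof.
rewrite -sumEFin; under eq_bigr do rewrite -joint_pmfE.
rewrite -measure_bigsetU_ord; last 2 first.
- by move=> i; exact: measurable_joint.
- apply/trivIsetP => i j _ _ ij; apply/seteqP; split => //= w [[_ Ji] [_ Jj]].
  by move: ij; rewrite -Ji -Jj eqxx.
congr (P _); apply/seteqP; split => w /=.
  by move=> Qw; rewrite (bigD1 (J w))//=; left; rewrite Qw.
by elim/big_ind : _ => // [A B HA HB [/HA|/HB]|i _ []].
Qed.

(** The fibres of [Q] partition the space, and z ^ Q is constant on each. *)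
Lemma integral_expX (z : R) : 0 < z ->
  (\int[P]_w (z ^+ Q w)%:E = \sum_(k <oo) (z ^+ k * \sum_i joint_pmf i k)%:E)%E.
Proof.
move=> z0.
have -> : [set: T] = \bigcup_k (Q @^-1` [set k]).
  by apply/seteqP; split => // w _; exists (Q w).
rewrite ge0_integral_bigcup//; last 3 first.
- apply/measurable_EFinP; apply: measurable_funTS.
  exact: (@measurableT_comp _ _ _ _ _ _ (fun n : nat => z ^+ n)).
- by move=> w _; rewrite lee_fin exprn_ge0// ltW.
- exact: trivIset_preimage1.
apply: eq_eseriesr => k _.
rewrite (eq_integral (fun=> (z ^+ k)%:E)); last first.
  by move=> w; rewrite inE/= => ->.
by rewrite integral_cst// EFinM -sum_joint_pmf.
Qed.

(** The total mass 1 is written as the expectation of 1 ^ Q, so that its series expansion dominates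
    the partial sums. *)
Lemma joint_pmf_le1 i N : \sum_(k < N) joint_pmf i k <= 1.
Proof.
rewrite -lee_fin.
have -> : 1%:E = (\int[P]_w (1 ^+ Q w)%:E)%E.
  under eq_integral do rewrite expr1n.
  by rewrite integral_cst// mul1e; apply/esym; exact: probability_setT.
rewrite integral_expX//.
apply: (@le_trans _ _
    (\sum_(0 <= k < N) (1 ^+ k * \sum_i joint_pmf i k)%:E)%E); last first.
  apply: nneseries_lim_ge => k _ _.
  by rewrite lee_fin mulr_ge0 ?exprn_ge0 ?sumr_ge0// => j _; exact: joint_pmf_ge0.
rewrite sumEFin lee_fin big_mkord; apply: ler_sum => k _.
rewrite expr1n mul1r (bigD1 i)//= lerDl sumr_ge0// => j _; exact: joint_pmf_ge0.
Qed.

Lemma Rintegral_expX (z : R) : 0 < z <= 1 ->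
  \int[P]_w z ^+ Q w = \sum_i gf joint_pmf z i.
Proof.
move=> z01; rewrite /Rintegral integral_expX; last by case/andP: z01.
rewrite -[RHS]/(fine (\sum_i gf joint_pmf z i)%:E); congr fine.
apply/cvg_lim => //.
rewrite (_ : (fun _ => _) =
  EFin \o (fun N => \sum_i gf_part joint_pmf z i N)); last first.
  apply/funext => N /=; rewrite sumEFin; congr EFin.
  rewrite big_mkord exchange_big/=; apply: eq_bigr => k _.
  by rewrite mulr_sumr.
apply: cvg_EFin; first exact: nearW.
apply: cvg_sumr => i; apply: cvg_gf => //.
- exact: joint_pmf_ge0.
- exact: joint_pmf_le1.
Qed.

End joint_distribution.
(** * The heavy-traffic limit *)

(** The bracket in [sigma2] is the variance of mu - lambda, which is its second moment once its mean
    vanishes. *)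
Lemma sigma2_mean_eq {R : realType} {d : nat} (p : 'rV[R]_d) (q : R)
    (lambda mu : 'I_d -> R) : mean p lambda = mean p mu ->
  sigma2 p q lambda mu =
  (\sum_i p 0 i * (mu i - lambda i) ^+ 2) * (2 / q) + 2 * mean p mu.
Proof.
move=> E; rewrite /sigma2 /var /cov E; congr (_ * _ + _).
move: (mean p mu) => m; rewrite /mean mulr_sumr -sumrB -big_split/=.
by apply: eq_bigr => i _; ring.
Qed.

(** The quotient lies between a and a exp (a e), by 1 + x <= exp x at x = a e and at x = - a e. *)
Lemma cvg_expRM_sub1_div {R : realType} {I : Type} (F : set_system I)
    {FF : Filter F} (e : I -> R) (a : R) : 0 <= a ->
  (\forall i \near F, 0 < e i) -> e i @[i --> F] --> 0 ->
  (expR (a * e i) - 1) / e i @[i --> F] --> a.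
Proof.
move=> a0 e0 ecvg.
have H : a * expR (a * e i) @[i --> F] --> a.
  rewrite -[X in _ --> X]mulr1 -[X in _ * X]expR0 -(mulr0 a).
  by apply: cvgMr; apply: continuous_cvg; [exact: continuous_expR|exact: cvgMr].
apply: (squeeze_cvgr _ (cvg_cst a) H).
near=> i; have ei : 0 < e i by near: i.
rewrite ler_pdivlMr// ler_pdivrMr//; apply/andP; split.
  by rewrite lerBrDl expR_ge1Dx.
have := expR_ge1Dx (- (a * e i)).
rewrite -(ler_pM2l (expR_gt0 (a * e i))) -expRD subrr expR0.
by rewrite mulrDr mulr1; lra.
Unshelve. all: by end_near. Qed.

Section steady_state.
Context {R : realType} {d : nat} (p : 'rV[R]_d) (q : R) (lambda mu : 'I_d -> R).
Context {disp} {T : measurableType disp} (P : probability T R).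
Variables (Q : {RV P >-> nat}) (J : T -> 'I_d).
Hypotheses (p_ge0 : forall i, 0 <= p 0 i) (p1 : \sum_i p 0 i = 1) (q0 : 0 < q).
Hypotheses (lambda_ge0 : forall i, 0 <= lambda i) (mu_ge0 : forall i, 0 <= mu i).
Hypothesis QJ : steady_state (queue_rate p q lambda mu) Q J.

Let u := joint_pmf Q J.

Let mJ i : measurable (J @^-1` [set i]) := QJ.1 i.

Let balance i k : u i k * (lambda i + (0 < k)%N%:R * mu i + q) =
  (0 < k)%N%:R * u i k.-1 * lambda i + u i k.+1 * mu i + q * p 0 i * \sum_j u j k.
Proof.
apply: (global_balance p_ge0 p1 q0 lambda_ge0 mu_ge0 _ QJ.2) => {}i {}k.
exact: joint_pmfE.
Qed.

Let gf1 : \sum_i gf u 1 i = 1.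
Proof.
rewrite -(Rintegral_expX Q mJ) ?ltr01 ?lexx//; under eq_Rintegral do rewrite expr1n.
rewrite Rintegral_cst// mul1r -[RHS]/(fine 1%E).
by congr fine; exact: probability_setT.
Qed.

Let u_ge0 := joint_pmf_ge0 Q J.
Let u_le1 := joint_pmf_le1 Q mJ.

Lemma steady_state_idle : \sum_i mu i * u i 0%N = mean p mu - mean p lambda.
Proof. exact: (idle_probability u_ge0 u_le1 balance q0 p1 gf1). Qed.

Lemma steady_state_pgf (z : R) : 0 < z <= 1 ->
  let s := z^-1 - 1 in
  let v i := mu i - lambda i * z in
  (forall i, s * v i < q) ->
  (\int[P]_w z ^+ Q w) * (\sum_i p 0 i * v i +
                     s * \sum_i p 0 i * v i ^+ 2 / (q - s * v i)) =
  mean p mu - mean p lambda + s * \sum_i mu i * u i 0%N * v i / (q - s * v i).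
Proof.
move=> z01 s v sv; rewrite (Rintegral_expX Q mJ)//.
exact: (gf_sum u_ge0 u_le1 balance q0 p1 gf1).
Qed.

End steady_state.

Theorem theorem3p2 (R : realType) (d : nat) (p : 'rV[R]_d) (q : R)
    (lambda0 mu : 'I_d -> R)
    (disp : R -> measure_display) (T : forall c, measurableType (disp c))
    (P : forall c, probability (T c) R)
    (Q : forall c, {RV P c >-> nat}) (J : forall c, T c -> 'I_d) :
  let rho0 := load p lambda0 mu in
  let lambda := fun (c : R) (i : 'I_d) => c * lambda0 i in
  let rho := fun c : R => load p (lambda c) mu in
  (forall i, 0 <= p 0 i) -> \sum_i p 0 i = 1 ->
  0 < q ->
  (forall i, 0 <= lambda0 i) -> (forall i, 0 <= mu i) ->
  0 < mean p mu ->
  0 < rho0 < 1 ->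
  (forall c : R, 0 < c < rho0^-1 ->
     steady_state (queue_rate p q (lambda c) mu) (Q c) (J c)) ->
  converges_in_distribution (at_left rho0^-1) (P := P)
    (fun c => scaled_queue_length (1 - rho c) (Q c))
    (exponential_prob (sigma2 p q (lambda rho0^-1) mu / (2 * mean p mu))^-1).
Proof.
move=> rho0 lambda rho p_ge0 p1 q0 lambda0_ge0 mu_ge0 m0 /andP[rho0_gt0 rho0_lt1] QJ.
set m := mean p mu in m0 *.
have meanl c : mean p (lambda c) = c * rho0 * m.
  rewrite /rho0 /load -/m mulrA mulfVK ?gt_eqF// /mean mulr_sumr.
  by apply: eq_bigr => i _; rewrite /lambda mulrCA.
have rhoE c : rho c = c * rho0 by rewrite /rho /load -/m meanl mulfK ?gt_eqF.
pose V i := mu i - lambda rho0^-1 i.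
pose W := \sum_i p 0 i * V i ^+ 2.
have W0 : 0 <= W by apply: sumr_ge0 => i _; rewrite mulr_ge0// sqr_ge0.
rewrite sigma2_mean_eq -/m -/W; last by rewrite meanl mulVf ?gt_eqF// mul1r.
set a := ((W * (2 / q) + 2 * m) / (2 * m))^-1.
have a0 : 0 < a.
  rewrite invr_gt0 divr_gt0 ?mulr_gt0// ltr_wpDl ?mulr_gt0//.
  by rewrite !mulr_ge0 ?invr_ge0// ltW.
pose eps c := 1 - rho c.
have c_near : \forall c \near at_left rho0^-1, 0 < c < rho0^-1.
  near=> c; apply/andP; split; last by near: c; exact: nbhs_left_lt.
  by near: c; apply: nbhs_left_gt; rewrite invr_gt0.
have eps_gt0 : \forall c \near at_left rho0^-1, 0 < eps c.
  near=> c; have /andP[_ c1] : 0 < c < rho0^-1 by near: c.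
  by rewrite /eps rhoE subr_gt0 -ltr_pdivlMr// div1r.
have eps_cvg : eps c @[c --> at_left rho0^-1] --> 0.
  rewrite -(subrr 1) -[X in 1 - X](mulVf (negbT (gt_eqF rho0_gt0))).
  apply: cvgB; first exact: cvg_cst.
  rewrite (funext rhoE).
  by apply: cvgMl; exact: cvg_at_left_filter.
apply: laplace_converges_exponential => //.
  near=> c => w; rewrite mulr_ge0// ltW//.
  by have : 0 < eps c by near: c.
move=> n.
pose z c := expR (- (n%:R * eps c)).
pose s c := expR (n%:R * eps c) - 1.
pose r c := s c / eps c.
pose v i c := mu i - lambda c i * z c.
pose u i c := mu i * joint_pmf (Q c) (J c) i 0%N.
pose L c := \int[P c]_w z c ^+ Q c w.
have ne_cvg : n%:R * eps c @[c --> at_left rho0^-1] --> (0 : R).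
  by rewrite -(mulr0 (n%:R : R)); exact: cvgMr.
have exp_cvg : expR (n%:R * eps c) @[c --> at_left rho0^-1] --> (1 : R).
  rewrite -[X in _ --> X]expR0.
  by apply: continuous_cvg => //; exact: continuous_expR.
have s_cvg : s c @[c --> at_left rho0^-1] --> (0 : R).
  by rewrite -(subrr (1 : R)); apply: (cvgB exp_cvg); exact: cvg_cst.
have z_cvg : z c @[c --> at_left rho0^-1] --> (1 : R).
  rewrite -invr1 (_ : z = fun c => (expR (n%:R * eps c))^-1); last first.
    by apply/funext => c; rewrite /z expRN.
  by apply: cvgV => //; rewrite oner_eq0.
have r_cvg : r c @[c --> at_left rho0^-1] --> (n%:R : R)
  by exact: cvg_expRM_sub1_div.
have v_cvg i : v i c @[c --> at_left rho0^-1] --> V i.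
  rewrite /V -[lambda _ i]mulr1; apply: cvgB; first exact: cvg_cst.
  by apply: cvgM => //; apply: cvgMl; exact: cvg_at_left_filter.
(* There are finitely many background states, so one neighbourhood works for all of them. *)
have sv_lt : \forall c \near at_left rho0^-1, forall i, s c * v i c < q.
  apply: filter_forall => i.
  have : s c * v i c @[c --> at_left rho0^-1] --> (0 * V i : R)
    by exact: cvgM.
  by rewrite mul0r => /cvgr_lt; apply.
have qsv_cvg i : (q - s c * v i c)^-1 @[c --> at_left rho0^-1] --> q^-1.
  apply: cvgV; first by rewrite gt_eqF.
  rewrite -[X in _ --> X]subr0 -(mul0r (V i)).
  by apply: cvgB; [exact: cvg_cst|exact: cvgM].
(* These terms are nonnegative and add up to m eps by the idle probability, so each is squeezed to
   0. *)
have u_cvg i : u i c @[c --> at_left rho0^-1] --> 0.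
  apply: (@squeeze_cvgr _ _ _ _ (fun=> 0) (fun c => m * eps c)); last 2 first.
  - exact: cvg_cst.
  - by rewrite -(mulr0 m); exact: cvgMr.
  near=> c; have c0 : 0 < c < rho0^-1 by near: c.
  have lc i' : 0 <= lambda c i' by rewrite mulr_ge0// ltW//; case/andP: c0.
  have u0 j : 0 <= u j c by rewrite mulr_ge0// joint_pmf_ge0.
  rewrite u0/=.
  have -> : m * eps c = \sum_i u i c.
    rewrite (steady_state_idle p_ge0 p1 q0 lc mu_ge0 (QJ c c0)) meanl -/m.
    by rewrite /eps rhoE; ring.
  by rewrite (bigD1 i)//= lerDl sumr_ge0.
(* [D] is the factor multiplying the transform [L], and [E] the right-hand side of
   [steady_state_pgf], both divided by eps. *)
pose D c := m * (1 + (1 - eps c) * (z c * r c)) +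
  r c * \sum_i p 0 i * v i c ^+ 2 * (q - s c * v i c)^-1.
pose E c := m + r c * \sum_i u i c * v i c * (q - s c * v i c)^-1.
pose D0 := m * (1 + n%:R) + n%:R * (W / q).
have D0_gt0 : 0 < D0.
  rewrite ltr_pwDl//; first by rewrite mulr_gt0// ltr_pwDl.
  by rewrite mulr_ge0// divr_ge0// ltW.
have D_cvg : D c @[c --> at_left rho0^-1] --> D0.
  apply: cvgD.
    apply: cvgMr; apply: cvgD; first exact: cvg_cst.
    rewrite [X in _ --> X](_ : _ = (1 - 0) * (1 * n%:R)); last by ring.
    by apply: cvgM; [apply: cvgB => //; exact: cvg_cst|exact: cvgM].
  apply: cvgM => //; rewrite /W mulr_suml; apply: cvg_sumr => i.
  by apply: cvgM => //; apply: cvgMr; rewrite expr2; apply: cvgM.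
have E_cvg : E c @[c --> at_left rho0^-1] --> m.
  rewrite -[X in _ --> X]addr0; apply: cvgD; first exact: cvg_cst.
  rewrite -[X in _ --> X](mulr0 (n%:R : R)); apply: cvgM => //.
  rewrite [X in _ --> X](_ : _ = \sum_i 0 * V i / q); last first.
    by rewrite big1// => i _; rewrite !mul0r.
  by apply: cvg_sumr => i; apply: cvgM => //; exact: cvgM.
have LDE : \forall c \near at_left rho0^-1, L c = E c / D c.
  near=> c.
  have c0 : 0 < c < rho0^-1 by near: c.
  have e0 : 0 < eps c by near: c.
  have Dc : 0 < D c by near: c; exact: cvgr_gt D0_gt0.
  have lc i : 0 <= lambda c i by rewrite mulr_ge0// ltW//; case/andP: c0.
  have z01 : 0 < z c <= 1.
    by rewrite expR_gt0 -expR0 ler_expR oppr_le0 mulr_ge0// ltW.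
  have sE : (z c)^-1 - 1 = s c by rewrite /z expRN invrK.
  have := steady_state_pgf p_ge0 p1 q0 lc mu_ge0 (QJ c c0) z01.
  rewrite /= sE => /(_ _)-H.
  have {}H : L c * (\sum_i p 0 i * v i c +
      s c * \sum_i p 0 i * v i c ^+ 2 * (q - s c * v i c)^-1) =
      m - mean p (lambda c) + s c * \sum_i u i c * v i c * (q - s c * v i c)^-1.
    by apply: H; near: c.
  have sr : s c = eps c * r c by rewrite /r mulrC divfK ?gt_eqF.
  (* The sum is m (1 - (1 - eps) z), and 1 - z = z s = eps z r brings out the factor eps. *)
  have pv : \sum_i p 0 i * v i c = m * eps c * (1 + (1 - eps c) * (z c * r c)).
    rewrite (eq_bigr (fun i => p 0 i * mu i - p 0 i * lambda c i * z c)); last first.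
      by move=> i _; rewrite /v; ring.
    rewrite sumrB -mulr_suml -/(mean p mu) -/(mean p (lambda c)) meanl -/m.
    have zs : z c * s c = 1 - z c.
      by rewrite -sE mulrBr mulfV ?mulr1// gt_eqF// expR_gt0.
    have ce : c * rho0 = 1 - eps c by rewrite /eps rhoE; ring.
    rewrite ce; move: zs; rewrite sr => zs.
    have -> : m * eps c * (1 + (1 - eps c) * (z c * r c)) =
      m * (eps c + (1 - eps c) * (z c * (eps c * r c))) by ring.
    by rewrite zs; ring.
  apply: (mulIf (negbT (gt_eqF Dc))); rewrite divfK ?gt_eqF//.
  apply: (mulfI (negbT (gt_eqF e0))).
  have me : m - c * rho0 * m = eps c * m by rewrite /eps rhoE; ring.
  rewrite /D /E; move: H.
  set X := \sum_i p 0 i * v i c ^+ 2 * _; set Y := \sum_i u i c * v i c * _.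
  by rewrite pv meanl me sr; lra.
rewrite (_ : a / (a + n%:R) = m / D0); last first.
  (* By the choice of a, m / a = m + W / q. *)
  have D0E : D0 = m * (a + n%:R) * a^-1.
    rewrite mulrDr mulrDl -!mulrA mulfV ?gt_eqF// /D0 mulrDr -addrA; congr (_ + _).
    by rewrite /a invrK; field; rewrite !gt_eqF.
  have an0 : 0 < a + n%:R by rewrite ltr_wpDr.
  by rewrite D0E; field; rewrite !gt_eqF.
apply: (@cvg_trans _ (E c / D c @[c --> at_left rho0^-1])); last first.
  by apply: cvgM => //; apply: cvgV => //; rewrite gt_eqF.
apply: near_eq_cvg; near=> c.
rewrite -(_ : L c = E c / D c); last by near: c.
(* Both integrands are exp (- n eps Q): the n-th power of exp (- eps Q) is z ^ Q. *)
apply: eq_Rintegral => w _ /=; rewrite /z /scaled_queue_length -!expRM_natl.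
by congr expR; rewrite -/(eps c); ring.
Unshelve. all: by end_near. Qed.
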